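(* Let $P \subseteq \mathbb{R}^n$ be a (non-degenerate, convex) regular polytope. Then $P$ is Wythoffian.
   Context: A (convex) polytope is the convex hull of a finite set of points in $\mathbb{R}^n$ ($n\ge 1$); it is non-degenerate if it is not contained in a hyperplane (affine subspace of dimension $n-1$). A face of $P$ is a set $P \cap \{y : c^T y = c_0\}$ where $c\in\mathbb{R}^n$, $c_0\in\mathbb{R}$ and $c^T y \le c_0$ for all $y \in P$; its dimension is the dimension of its affine hull. A facet is an $(n-1)$-dimensional face. A symmetry of $P$ is an (affine) isometry of $\mathbb{R}^n$ mapping $P$ to itself. A flag is a chain $F_0 \subseteq F_1 \subseteq \cdots \subseteq F_n$ with $F_i$ an $i$-dimensional face of $P$. $P$ is regular if its symmetry group acts transitively on its flags. Uniform polytopes are defined inductively (each polytope being regarded as non-degenerate in its own affine hull): every segment is uniform; a polygon is uniform if and only if it is a regular polygon; a polytope of dimension at least $3$ is uniform if all its facets are uniform and its symmetry group acts transitively on its vertices. A polytope $P \subseteq \mathbb{R}^n$ is Wythoffian if it is uniform and, up to a translation of $\mathbb{R}^n$, it equals $\operatorname{conv}(Wx)$, the convex hull of the orbit of some point $x \in \mathbb{R}^n$ under some finite subgroup $W \subseteq O(n)$ generated by reflections in hyperplanes through the origin. *)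

(* Defs.v *)
From mathcomp Require Import all_boot all_order all_algebra.
From mathcomp Require Import boolp classical_sets functions cardinality reals.

Set Implicit Arguments.
Unset Strict Implicit.
Unset Printing Implicit Defensive.

Import Order.TTheory GRing.Theory Num.Theory.
Local Open Scope classical_set_scope.
Local Open Scope ring_scope.

(* Points of R^n are row vectors, on which matrices act on the
   right; [set 'rV[R]_n] is a subset of R^n.

   Everything about a polytope is relative to its own affine hull, so that a
   d-dimensional polytope of R^n can be treated as a non-degenerate polytope
   of a d-dimensional space. When P is non-degenerate its affine hull is R^n. *)

Section Polytopes.
Variables (R : realType) (n : nat).
Local Notation point := 'rV[R]_n.
Implicit Types (A H P F : set point) (W G : set 'M[R]_n).

Definition dot (u v : point) : R := (u *m v^T) 0 0.

Definition dist (u v : point) : R := Num.sqrt (dot (u - v) (u - v)).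

Definition conv A : set point :=
  [set x | exists (k : nat) (p : 'I_k -> point) (l : 'I_k -> R),
     [/\ forall i, A (p i), forall i, 0 <= l i,
         \sum_i l i = 1 & x = \sum_i l i *: p i]].

Definition aff A : set point :=
  [set x | exists (k : nat) (p : 'I_k -> point) (l : 'I_k -> R),
     [/\ forall i, A (p i), \sum_i l i = 1 & x = \sum_i l i *: p i]].

Definition affine_subspace (k : nat) H : Prop :=
  exists (p : point) (U : {vspace point}),
    \dim U = k /\ H = [set p + u | u in [set` U]].

(* The empty set has no dimension in this sense. *)
Definition has_dim A (k : nat) : Prop := affine_subspace k (aff A).

Definition polytope P : Prop := exists s : seq point, P = conv [set` s].

(* Only meaningful for n >= 1. *)
Definition non_degenerate P : Prop :=
  forall H, affine_subspace n.-1 H -> ~ (P `<=` H).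

Definition face P F : Prop :=
  exists (c : point) (c0 : R),
    (forall y, P y -> dot c y <= c0) /\ F = P `&` [set y | dot c y = c0].

Definition vertex P (v : point) : Prop := face P [set v].

(* f is an isometry of aff P mapping P to itself; the values of f outside
   aff P are irrelevant. *)
Definition symmetry P (f : point -> point) : Prop :=
  [/\ forall x y, aff P x -> aff P y -> dist (f x) (f y) = dist x y,
      f @` aff P = aff P & f @` P = P].

(* In this and the next definition, d is meant to be the dimension of P. *)
Definition flag (d : nat) P (F : 'I_d.+1 -> set point) : Prop :=
  (forall i, face P (F i) /\ has_dim (F i) i) /\
  (forall i j : 'I_d.+1, (i <= j)%N -> F i `<=` F j).

Definition regular_polytope (d : nat) P : Prop :=
  forall F G : 'I_d.+1 -> set point, flag P F -> flag P G ->
    exists2 f, symmetry P f & forall i, f @` F i = G i.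

Definition vertex_transitive P : Prop :=
  forall v w, vertex P v -> vertex P w -> exists2 f, symmetry P f & f v = w.

(* P is a uniform polytope of dimension d. The definition starts with segments,
   so no 0-dimensional polytope is uniform. *)
Fixpoint uniform_polytope (d : nat) P : Prop :=
  [/\ polytope P, has_dim P d &
   match d with
   | 0 => False
   | 1 => True
   | 2 => regular_polytope 2 P
   | d'.+1 => (forall F, face P F -> has_dim F d' -> uniform_polytope d' F) /\
              vertex_transitive P
   end].

Definition orthogonal_group : set 'M[R]_n := [set M | M *m M^T = 1%:M].

Definition orthogonal_subgroup G : Prop :=
  [/\ G `<=` orthogonal_group, G 1%:M,
      forall M N, G M -> G N -> G (M *m N) & forall M, G M -> G (invmx M)].

(* x *m reflection_mx a = x - 2 (x . a) / (a . a) a *)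
Definition reflection_mx (a : point) : 'M[R]_n :=
  1%:M - (2 / dot a a) *: (a^T *m a).

Definition finite_reflection_group W : Prop :=
  finite_set W /\
  exists2 S : set 'M[R]_n, S `<=` [set reflection_mx a | a in [set~ 0]] &
    W = smallest orthogonal_subgroup S.

Definition wythoffian P : Prop :=
  (exists d, uniform_polytope d P) /\
  exists W (x t : point), finite_reflection_group W /\
    P = [set t + y | y in conv [set x *m M | M in W]].

End Polytopes.

(* Main.v *)
Require Import Defs.
From mathcomp Require Import all_boot all_order all_algebra.
From mathcomp Require Import boolp classical_sets functions cardinality reals.
From mathcomp Require Import ring lra.

(** Uniformity. Every vertex of a polytope belongs to a flag ([chain_above]), so
    flag-transitivity gives vertex-transitivity. A flag of a facet F extends by
    P to a flag of P; a symmetry matching two such extensions preserves F, and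
    being affine it preserves the affine hull of F too. So the facets of a
    regular polytope are regular, and uniformity follows by induction on the
    dimension ([regular_uniform]).

    The reflection group. Let vw be an edge of P. Two flags that agree except
    that one starts with v and the other with w are matched by a symmetry of P.
    It fixes the centroids of the vertices of all faces of dimension at least 1
    in these flags. These are n affinely independent points, the last one being
    the center t of P. An isometry that fixes n such points and moves v to w is
    the reflection in the bisector of v and w ([edge_reflection]). Let W be the
    group generated by the linear reflections that preserve P - t. It is finite, because a linear symmetry of P - t is determined by the permutation
    it induces on the vertices.

    Transitivity on vertices. Instead of showing that the edge graph of P is
    connected, one uses the simplex method: a vertex that does not maximise a
    functional c over P is the endpoint of an edge along which c increases
    ([improving_edge]). Given a vertex p, let c be maximal over P only at p, and
    let u maximise c on the W-orbit of a fixed vertex v. If u were not p, the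
    reflection along an improving edge at u would give a better point of the
    orbit. So the orbit of v is the whole vertex set, and P is its convex hull.

    The convex geometry behind this is elementary. A polytope is the hull of its
    vertices by Gordan's alternative ([gordan]), and both facets through a given
    face and improving edges are found by rotating a supporting hyperplane until
    it meets a further generator ([rotate_support]). *)

Set Implicit Arguments.
Unset Strict Implicit.
Unset Printing Implicit Defensive.

Import Order.TTheory GRing.Theory Num.Theory.

(** * The dot product *)

Section Dot.
Local Open Scope ring_scope.
Variables (R : realType) (n : nat).
Implicit Types (x y z : 'rV[R]_n) (a : R).

Lemma dotE x y : dot x y = \sum_i x 0 i * y 0 i.
Proof. by rewrite /dot mxE; apply: eq_bigr => i _; rewrite mxE. Qed.

Lemma dotC x y : dot x y = dot y x.
Proof. by rewrite !dotE; apply: eq_bigr => i _; rewrite mulrC. Qed.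

Lemma dotDl x y z : dot (x + y) z = dot x z + dot y z.
Proof. by rewrite /dot mulmxDl mxE. Qed.

Lemma dotZl a x z : dot (a *: x) z = a * dot x z.
Proof. by rewrite /dot -scalemxAl mxE. Qed.

Lemma dotNl x z : dot (- x) z = - dot x z.
Proof. by rewrite -scaleN1r dotZl mulN1r. Qed.

Lemma dotBl x y z : dot (x - y) z = dot x z - dot y z.
Proof. by rewrite dotDl dotNl. Qed.

Lemma dot0l z : dot 0 z = 0.
Proof. by rewrite /dot mul0mx mxE. Qed.

Lemma dotDr x y z : dot z (x + y) = dot z x + dot z y.
Proof. by rewrite dotC dotDl !(dotC z). Qed.

Lemma dotZr a x z : dot z (a *: x) = a * dot z x.
Proof. by rewrite dotC dotZl dotC. Qed.

Lemma dotNr x z : dot z (- x) = - dot z x.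
Proof. by rewrite dotC dotNl dotC. Qed.

Lemma dotBr x y z : dot z (x - y) = dot z x - dot z y.
Proof. by rewrite dotDr dotNr. Qed.

Lemma dot0r z : dot z 0 = 0.
Proof. by rewrite dotC dot0l. Qed.

Lemma dot_suml (I : Type) (r : seq I) (Q : pred I) (f : I -> 'rV[R]_n) z :
  dot (\sum_(i <- r | Q i) f i) z = \sum_(i <- r | Q i) dot (f i) z.
Proof.
exact: (big_morph (fun x => dot x z) (fun x y => dotDl x y z) (dot0l z)).
Qed.

Lemma dot_sumr (I : Type) (r : seq I) (Q : pred I) (f : I -> 'rV[R]_n) z :
  dot z (\sum_(i <- r | Q i) f i) = \sum_(i <- r | Q i) dot z (f i).
Proof. by rewrite dotC dot_suml; apply: eq_bigr => i _; rewrite dotC. Qed.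

Definition dot_linear := (dotDl, dotDr, dotNl, dotNr, dotZl, dotZr).

Lemma dot_ge0 x : 0 <= dot x x.
Proof. by rewrite dotE sumr_ge0 // => i _; rewrite -expr2 sqr_ge0. Qed.

Lemma dot_eq0 x : dot x x = 0 -> x = 0.
Proof.
rewrite dotE => /eqP; rewrite psumr_eq0 => [/allP h|i _]; last first.
  by rewrite -expr2 sqr_ge0.
apply/rowP => i; rewrite mxE; have := h i (mem_index_enum i).
by rewrite mulf_eq0 orbb => /eqP.
Qed.

Lemma dot_gt0 x : x != 0 -> 0 < dot x x.
Proof.
by move=> x0; rewrite lt0r dot_ge0 andbT; apply: contra_neq x0; exact: dot_eq0.
Qed.

Lemma dist_eq x y (z w : 'rV[R]_n) :
  dist x y = dist z w -> dot (x - y) (x - y) = dot (z - w) (z - w).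
Proof.
by move=> h; rewrite -[LHS]sqr_sqrtr ?dot_ge0 // -[RHS]sqr_sqrtr ?dot_ge0 //; congr (_ ^+ 2).
Qed.

(** A functional separating a vector from a subspace is obtained by taking a
    nonzero coordinate of the projection along that subspace. *)
Lemma dot_separate_vspace (U : {vspace 'rV[R]_n}) u :
  u \notin U -> exists2 e, {in U, forall w, dot e w = 0} & dot e u != 0.
Proof.
move=> uU; pose g (y : 'rV[R]_n) := y - projv U y.
have gB : {morph g : x y / x + y} by move=> x y; rewrite /g linearD opprD addrACA.
have gZ a y : g (a *: y) = a *: g y by rewrite /g linearZ scalerBr.
have : g u != 0.
  apply: contraNneq uU => /eqP; rewrite subr_eq0 => /eqP ->; exact: memv_proj.
case/rV0Pn => i gui; pose e := \row_j (g (delta_mx 0 j)) 0 i.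
have eE y : dot e y = g y 0 i.
  rewrite [in RHS](row_sum_delta y) (big_morph g gB (_ : g 0 = 0)); last first.
    by rewrite /g linear0 subr0.
  rewrite summxE dotE; apply: eq_bigr => j _.
  by rewrite gZ !mxE mulrC.
exists e; last by rewrite eE.
by move=> w wU; rewrite eE /g projv_id // subrr mxE.
Qed.

End Dot.

(** * Convex and affine hulls *)

Section Combinations.
Local Open Scope classical_set_scope.
Local Open Scope ring_scope.
Variables (R : realType) (n : nat).
Local Notation point := 'rV[R]_n.
Implicit Types (A B C : set point) (x y z c v : point) (a : R).

Lemma conv_fin A (I : finType) (p : I -> point) (l : I -> R) :
  (forall i, A (p i)) -> (forall i, 0 <= l i) -> \sum_i l i = 1 ->
  conv A (\sum_i l i *: p i).
Proof.
move=> pA l0 l1; exists #|I|, (p \o enum_val), (l \o enum_val); split => //=.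
  by rewrite -l1 (reindex _ (onW_bij _ (enum_val_bij I))).
by rewrite (reindex _ (onW_bij _ (enum_val_bij I))).
Qed.

Lemma aff_fin A (I : finType) (p : I -> point) (l : I -> R) :
  (forall i, A (p i)) -> \sum_i l i = 1 -> aff A (\sum_i l i *: p i).
Proof.
move=> pA l1; exists #|I|, (p \o enum_val), (l \o enum_val); split => //=.
  by rewrite -l1 (reindex _ (onW_bij _ (enum_val_bij I))).
by rewrite (reindex _ (onW_bij _ (enum_val_bij I))).
Qed.

Lemma sub_conv A : A `<=` conv A.
Proof.
move=> x Ax; exists 1%N, (fun=> x), (fun=> 1).
by split => //; rewrite big_ord1 ?scale1r.
Qed.

Lemma conv_sub_aff A : conv A `<=` aff A.
Proof. by move=> x [k [p [l [pA _ l1 ->]]]]; exists k, p, l. Qed.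

Lemma sub_aff A : A `<=` aff A.
Proof. by move=> x /sub_conv/conv_sub_aff. Qed.

Lemma conv_mono A B : A `<=` B -> conv A `<=` conv B.
Proof.
by move=> AB x [k [p [l [pA l0 l1 ->]]]]; exists k, p, l; split => // i; exact/AB.
Qed.

Lemma aff_line A x y z a : aff A x -> aff A y -> aff A z -> aff A (x + a *: (y - z)).
Proof.
move=> [k1 [p1 [l1 [A1 s1 ->]]]] [k2 [p2 [l2 [A2 s2 ->]]]] [k3 [p3 [l3 [A3 s3 ->]]]].
pose p (i : ('I_k1 + ('I_k2 + 'I_k3))%type) : point :=
  match i with inl i => p1 i | inr (inl i) => p2 i | inr (inr i) => p3 i end.
pose l (i : ('I_k1 + ('I_k2 + 'I_k3))%type) : R :=
  match i with inl i => l1 i | inr (inl i) => a * l2 i | inr (inr i) => - (a * l3 i) end.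
have -> : \sum_i l1 i *: p1 i + a *: (\sum_i l2 i *: p2 i - \sum_i l3 i *: p3 i)
    = \sum_i l i *: p i.
  rewrite scalerBr !scaler_sumr -sumrN !big_sumType /=; congr (_ + _).
  congr (_ + _); apply: eq_bigr => i _.
    by rewrite scalerA.
  by rewrite scalerA scaleNr.
apply: aff_fin; first by case=> [|[]].
by rewrite !big_sumType /= sumrN -!mulr_sumr s1 s2 s3; ring.
Qed.

Lemma comb_nonempty (k : nat) (l : 'I_k -> R) : \sum_i l i = 1 -> exists k', k = k'.+1.
Proof.
case: k l => [|k] l; last by exists k.
by rewrite big_ord0 => /esym/eqP; rewrite oner_eq0.
Qed.

(** Writing a combination relative to one of its points as base point avoids
    dividing by partial sums of weights, which may vanish here. *)
Lemma aff_least A C :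
  (forall x y z a, C x -> C y -> C z -> C (x + a *: (y - z))) ->
  A `<=` C -> aff A `<=` C.
Proof.
move=> Cl AC x [k [p [l [pA l1 ->]]]].
have [k' ek] := comb_nonempty l1; subst k.
have -> : \sum_i l i *: p i = p ord0 + \sum_i l i *: (p i - p ord0).
  rewrite [in RHS](eq_bigr (fun i => l i *: p i - l i *: p ord0)); last first.
    by move=> i _; rewrite scalerBr.
  by rewrite sumrB -scaler_suml l1 scale1r addrC subrK.
suff H y : C y -> C (y + \sum_i l i *: (p i - p ord0)) by apply: H; exact/AC.
elim: (index_enum _) y => [|i r IH] y Cy; first by rewrite big_nil addr0.
by rewrite big_cons addrA; apply: IH; apply: Cl => //; exact/AC.
Qed.

Lemma aff_sub A B : A `<=` aff B -> aff A `<=` aff B.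
Proof. by apply: aff_least => *; exact: aff_line. Qed.

Lemma aff_mono A B : A `<=` B -> aff A `<=` aff B.
Proof. by move=> AB; apply: aff_sub => x /AB/sub_aff. Qed.

Lemma aff_conv A : aff (conv A) = aff A.
Proof.
rewrite eqEsubset; split; first exact/aff_sub/conv_sub_aff.
exact/aff_mono/sub_conv.
Qed.

Lemma conv_convex A x y a : conv A x -> conv A y -> 0 <= a <= 1 ->
  conv A ((1 - a) *: x + a *: y).
Proof.
move=> [k1 [p1 [l1 [A1 g1 s1 ->]]]] [k2 [p2 [l2 [A2 g2 s2 ->]]]] /andP[a0 a1].
pose p (i : ('I_k1 + 'I_k2)%type) : point :=
  match i with inl i => p1 i | inr i => p2 i end.
pose l (i : ('I_k1 + 'I_k2)%type) : R :=
  match i with inl i => (1 - a) * l1 i | inr i => a * l2 i end.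
have -> : (1 - a) *: (\sum_i l1 i *: p1 i) + a *: (\sum_i l2 i *: p2 i)
    = \sum_i l i *: p i.
  rewrite !big_sumType /= !scaler_sumr.
  by congr (_ + _); apply: eq_bigr => i _; rewrite scalerA.
apply: conv_fin; first by case.
  by case=> i; rewrite mulr_ge0 // subr_ge0.
by rewrite !big_sumType /= -!mulr_sumr s1 s2; ring.
Qed.

Lemma conv_least A C :
  (forall x y a, C x -> C y -> 0 <= a <= 1 -> C ((1 - a) *: x + a *: y)) ->
  A `<=` C -> conv A `<=` C.
Proof.
move=> Cc AC x [k [p [l [pA l0 l1 ->]]]].
suff H : forall r : seq 'I_k, 0 < \sum_(i <- r) l i ->
    C ((\sum_(i <- r) l i)^-1 *: \sum_(i <- r) l i *: p i).
  by have := H (index_enum _); rewrite l1 invr1 scale1r; apply; exact: ltr01.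
elim=> [|i r IH]; first by rewrite big_nil ltxx.
rewrite !big_cons => S0.
set S := \sum_(j <- r) l j; set T := \sum_(j <- r) _.
have S_ge0 : 0 <= S by apply: sumr_ge0.
have [S1|S1] := eqVneq S 0.
  have T0 : T = 0.
    rewrite /T big_seq big1 // => j jr.
    move/eqP: S1; rewrite /S psumr_eq0 // => /allP/(_ _ jr)/= /eqP ->.
    by rewrite scale0r.
  move: S0; rewrite -/S S1 T0 !addr0 => li.
  by rewrite scalerA mulVf ?scale1r ?gt_eqF //; exact/AC.
have Sp : 0 < S by rewrite lt0r S1.
have LS : l i + S != 0 by rewrite gt_eqF // -/S.
have -> : (l i + S)^-1 *: (l i *: p i + T) =
    (1 - S / (l i + S)) *: p i + (S / (l i + S)) *: (S^-1 *: T).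
  rewrite scalerDr !scalerA; congr (_ *: _ + _ *: _).
    by field.
  by field; rewrite LS S1.
apply: Cc; [exact/AC | exact: IH |].
rewrite divr_ge0 //=; last exact: ltW.
by rewrite ler_pdivrMr // mul1r lerDr.
Qed.

Lemma conv_sub A B : A `<=` conv B -> conv A `<=` conv B.
Proof. by apply: conv_least => *; exact: conv_convex. Qed.

Lemma aff_dot_const A c a : (forall y, A y -> dot c y = a) -> forall y, aff A y -> dot c y = a.
Proof.
move=> h; apply: aff_least => // x y z b hx hy hz.
by rewrite dotDr dotZr dotBr hx hy hz subrr mulr0 addr0.
Qed.

Lemma conv_dot_le A c a : (forall y, A y -> dot c y <= a) -> forall y, conv A y -> dot c y <= a.
Proof.
move=> h; apply: conv_least => // x y b hx hy /andP[b0 b1].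
by rewrite dotDr !dotZr; nra.
Qed.

Lemma aff_nonempty A : aff A !=set0 -> A !=set0.
Proof.
move=> [x [k [p [l [pA l1 _]]]]]; have [k' ek] := comb_nonempty l1; subst k.
by exists (p ord0).
Qed.

Lemma conv_nonempty A : conv A !=set0 -> A !=set0.
Proof. by move=> [x /conv_sub_aff xA]; apply: aff_nonempty; exists x. Qed.

Lemma aff1 v : aff [set v] = [set v].
Proof.
rewrite eqEsubset; split; last exact: sub_aff.
by apply: aff_least => // x y z a /= -> -> ->; rewrite subrr scaler0 addr0.
Qed.

Lemma conv1 v : conv [set v] = [set v].
Proof.
by rewrite eqEsubset; split; [rewrite -{2}(aff1 v); exact: conv_sub_aff|exact: sub_conv].
Qed.

End Combinations.

(** * Isometries are affine *)

Section Isometries.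
Local Open Scope classical_set_scope.
Local Open Scope ring_scope.
Variables (R : realType) (n : nat).
Local Notation point := 'rV[R]_n.
Implicit Types (A B : set point).

(** The moment-of-inertia identity (Leibniz): the right-hand side only
    involves mutual distances of the points. *)
Lemma dot_barycenter (k : nat) (l : 'I_k -> R) (q : 'I_k -> point) (y : point) :
  \sum_i l i = 1 ->
  dot (y - \sum_i l i *: q i) (y - \sum_i l i *: q i) =
  \sum_i l i * dot (y - q i) (y - q i)
  - 2^-1 * \sum_i \sum_j l i * l j * dot (q i - q j) (q i - q j).
Proof.
move=> l1; set b := \sum_i _ *: _.
have E1 : \sum_i l i * dot (y - q i) (y - q i) =
    dot y y - 2 * dot y b + \sum_i l i * dot (q i) (q i).
  have -> : dot y y = \sum_i l i * dot y y by rewrite -mulr_suml l1 mul1r.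
  rewrite dot_sumr mulr_sumr -sumrB -big_split /=.
  apply: eq_bigr => i _.
  by rewrite dotZr !dot_linear (dotC (q i) y); ring.
have E2 : \sum_i \sum_j l i * l j * dot (q i - q j) (q i - q j) =
    2 * (\sum_i l i * dot (q i) (q i)) - 2 * dot b b.
  have -> : dot b b = \sum_i \sum_j l i * l j * dot (q i) (q j).
    rewrite dot_suml; apply: eq_bigr => i _; rewrite dotZl dot_sumr mulr_sumr.
    by apply: eq_bigr => j _; rewrite dotZr mulrA.
  have -> : 2 * (\sum_i l i * dot (q i) (q i)) =
     \sum_i \sum_j l i * l j * dot (q i) (q i) + \sum_i \sum_j l i * l j * dot (q j) (q j).
    rewrite [X in _ + X]exchange_big mulr_natl mulr2n /=.
    congr (_ + _); apply: eq_bigr => i _.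
      by rewrite -mulr_suml -mulr_sumr l1 mulr1.
    by rewrite -mulr_suml -mulr_suml l1 mul1r.
  rewrite mulr_sumr -big_split -sumrB; apply: eq_bigr => i _.
  rewrite mulr_sumr -big_split -sumrB; apply: eq_bigr => j _.
  by rewrite /= !dot_linear (dotC (q j) (q i)); ring.
rewrite E1 E2 !dot_linear (dotC b y); lra.
Qed.

Definition affine_on A (f : point -> point) :=
  forall (k : nat) (p : 'I_k -> point) (l : 'I_k -> R),
    (forall i, A (p i)) -> \sum_i l i = 1 ->
    f (\sum_i l i *: p i) = \sum_i l i *: f (p i).

Lemma affine_on_sub A B f : A `<=` B -> affine_on B f -> affine_on A f.
Proof. by move=> AB fB k p l pA; apply: fB => i; exact/AB. Qed.

(** An isometry carries a barycenter to the point with the same distances to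
    the images, which by the identity above is the barycenter of the images. *)
Lemma isometry_affine A (f : point -> point) :
  (forall x y, aff A x -> aff A y -> dist (f x) (f y) = dist x y) ->
  affine_on (aff A) f.
Proof.
move=> fi k p l pA l1; set b := \sum_i l i *: p i.
have bA : aff A b.
  apply: (@aff_sub _ _ [set` codom p]); first by move=> x /= /codomP[i ->].
  by apply: aff_fin => // i /=; exact: codom_f.
apply/eqP; rewrite -subr_eq0; apply/eqP/dot_eq0.
rewrite dot_barycenter //.
have E := dot_barycenter p b l1; rewrite -/b subrr dot0l in E.
rewrite [RHS]E; congr (_ - _ * _).
  by apply: eq_bigr => i _; congr (_ * _); apply: dist_eq; exact: fi.
apply: eq_bigr => i _; apply: eq_bigr => j _; congr (_ * _).
by apply: dist_eq; exact: fi.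
Qed.

Lemma image_conv A (f : point -> point) :
  affine_on A f -> f @` conv A = conv (f @` A).
Proof.
move=> fb; rewrite eqEsubset; split.
  move=> _ [x [k [p [l [pA l0 l1 ->]]]] <-]; rewrite fb //.
  by apply: conv_fin => // i; exists (p i).
move=> x [k [p [l [pA l0 l1 ->]]]].
have [q qA] := choice (fun i => let: ex_intro2 q h e := pA i in ex_intro _ q (conj h e)).
exists (\sum_i l i *: q i); first by apply: conv_fin => // i; case: (qA i).
rewrite fb // => [|i]; last by case: (qA i).
by apply: eq_bigr => i _; case: (qA i) => _ ->.
Qed.

Lemma image_aff A (f : point -> point) :
  affine_on A f -> f @` aff A = aff (f @` A).
Proof.
move=> fb; rewrite eqEsubset; split.
  move=> _ [x [k [p [l [pA l1 ->]]]] <-]; rewrite fb //.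
  by apply: aff_fin => // i; exists (p i).
move=> x [k [p [l [pA l1 ->]]]].
have [q qA] := choice (fun i => let: ex_intro2 q h e := pA i in ex_intro _ q (conj h e)).
exists (\sum_i l i *: q i); first by apply: aff_fin => // i; case: (qA i).
rewrite fb // => [|i]; last by case: (qA i).
by apply: eq_bigr => i _; case: (qA i) => _ ->.
Qed.

End Isometries.

(** * Dimension of affine hulls *)

Section Dimension.
Local Open Scope classical_set_scope.
Local Open Scope ring_scope.
Variables (R : realType) (n : nat).
Local Notation point := 'rV[R]_n.
Implicit Types (A B : set point) (x y z c : point) (a : R).

Lemma dimv_add_line (U : {vspace point}) u : u \notin U -> \dim (U + <[u]>)%VS = (\dim U).+1.
Proof.
move=> uU; rewrite dimv_disjoint_sum; last first.
  apply/eqP; rewrite -subv0; apply/subvP => w; rewrite memv_cap => /andP[wU /vlineP[k ek]].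
  rewrite memv0; apply: contraNT uU; rewrite ek => ku0.
  have k0 : k != 0 by apply: contraNneq ku0 => ->; rewrite scale0r.
  by rewrite -[u]scale1r -(mulVf k0) -scalerA memvZ // -ek.
rewrite dim_vline; case: eqVneq uU => [->|_ _]; first by rewrite mem0v.
by rewrite addn1.
Qed.

Lemma dim_point : \dim {:point} = n.
Proof. by rewrite dimvf /dim /= mul1n. Qed.

Lemma has_dim_direction A k x : has_dim A k -> aff A x ->
  exists2 U : {vspace point}, \dim U = k & forall y, aff A y <-> y - x \in U.
Proof.
move=> [p [U [dU ->]]] [u /= uU <-]; exists U => // y; split.
  by move=> [w /= wU <-]; rewrite opprD addrACA subrr add0r memvB.
move=> h; exists (y - (p + u) + u); first by rewrite /= memvD.
by rewrite addrC opprD addrA !subrK.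
Qed.

Lemma has_dim_nonempty A k : has_dim A k -> A !=set0.
Proof.
move=> [p [U [_ e]]]; apply: aff_nonempty; exists p; rewrite e.
by exists 0; rewrite /= ?mem0v ?addr0.
Qed.

(** With a common base point this is the comparison of direction spaces. *)
Lemma has_dim_mono A B k l : has_dim A k -> has_dim B l -> aff A `<=` aff B ->
  (k <= l)%N /\ (k = l -> aff A = aff B).
Proof.
move=> hA hB AB; have [x xA] := has_dim_nonempty hA.
have xA' := sub_aff xA; have xB := AB _ xA'.
have [U dU UE] := has_dim_direction hA xA'.
have [V dV VE] := has_dim_direction hB xB.
have UV : (U <= V)%VS.
  apply/subvP => w wU; have /VE : aff B (x + w).
    by apply: AB; apply/UE; rewrite addrC addKr.
  by rewrite addrC addKr.
rewrite -dU -dV dimvS //; split=> // dd.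
have /eqP eUV : U == V by rewrite eqEdim UV dd leqnn.
by apply/seteqP; split=> // y /VE; rewrite -eUV => /UE.
Qed.

Lemma has_dim_inj A k l : has_dim A k -> has_dim A l -> k = l.
Proof.
move=> hk hl; apply/eqP; rewrite eqn_leq.
by rewrite (has_dim_mono hk hl _).1 // (has_dim_mono hl hk _).1.
Qed.

(** A maximal linear space of directions along which one can move inside the
    affine hull exhausts it. *)
Lemma has_dim_exists A : A !=set0 -> exists k, has_dim A k.
Proof.
move=> [x Ax]; have xA := sub_aff Ax.
pose Q m := `[<exists U : {vspace point}, \dim U = m /\ {in U, forall u, aff A (x + u)}>].
have Q0 : exists m, Q m.
  exists 0%N; apply/asboolP; exists 0%VS; split; first by rewrite dimv0.
  by move=> u; rewrite memv0 => /eqP ->; rewrite addr0.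
have Qb m : Q m -> (m <= n)%N.
  by move=> /asboolP[U [<- _]]; rewrite -[leqRHS]dim_point dimvS // subvf.
have [k /asboolP[U [dU UA]] kmax] := ex_maxnP Q0 Qb.
exists k, x, U; split => //; apply/seteqP; split=> [y yA|_ [u uU <-]]; last exact: UA.
exists (y - x); last by rewrite addrC subrK.
rewrite /=; apply: contrapT => /negP yU.
have /kmax : Q k.+1; last by rewrite ltnn.
apply/asboolP; exists (U + <[y - x]>)%VS; split; first by rewrite dimv_add_line // dU.
move=> w /memv_addP[u uU [_ /vlineP[a ->] ->]]; rewrite addrA.
by apply: aff_line => //; exact: UA.
Qed.

Lemma has_dim1 (v : point) : has_dim [set v] 0.
Proof.
exists v, 0%VS; split; first by rewrite dimv0.
rewrite aff1; apply/seteqP; split=> [_ /= -> |_ [u /= + <-]].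
  by exists 0; rewrite ?addr0 //= mem0v.
by rewrite memv0 => /eqP ->; rewrite addr0.
Qed.

Lemma has_dim0 A : has_dim A 0 -> exists v, A = [set v].
Proof.
move=> hA; have [v vA] := has_dim_nonempty hA; exists v.
have [U /eqP] := has_dim_direction hA (sub_aff vA).
rewrite dimv_eq0 => /eqP -> UE; apply/seteqP; split=> [y Ay /=|y /= -> //].
by have /UE := sub_aff Ay; rewrite memv0 subr_eq0 => /eqP.
Qed.

End Dimension.

(** * Faces *)

Section Faces.
Local Open Scope classical_set_scope.
Local Open Scope ring_scope.
Variables (R : realType) (n : nat).
Local Notation point := 'rV[R]_n.
Implicit Types (A B P F G : set point) (x y z c : point) (a : R) (s : seq point).

(** Used to perturb functionals without losing finitely many strict inequalities. *)
Lemma dominating_scale (T : eqType) (s : seq T) (a b : T -> R) :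
  {in s, forall t, 0 < a t} -> exists N, {in s, forall t, 0 < N * a t + b t}.
Proof.
elim: s => [|x s IH] h; first by exists 0.
have [|N hN] := IH; first by move=> y ys; rewrite h // inE ys orbT.
have ax : 0 < a x by apply: h; rewrite mem_head.
pose M := `|b x| / a x + 1.
exists (`|N| + M) => y; rewrite inE => /predU1P[->|ys].
  rewrite /M 2!mulrDl divfK ?gt_eqF // mul1r -addrA ltr_wpDl ?mulr_ge0 //; first exact: ltW.
  by have := ler_norm (- b x); rewrite normrN; lra.
have ay : 0 < a y by apply: h; rewrite inE ys orbT.
have M0 : 0 <= M by rewrite addr_ge0 // divr_ge0 // ltW.
apply: lt_le_trans (hN _ ys) _; rewrite lerD2r ler_pM2r //.
by apply: le_trans (ler_norm N) _; rewrite lerDl.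
Qed.

(** In a convex combination on which a functional attains its maximum, every
    point of positive weight is itself a maximiser; the points of weight zero
    can be replaced by one of positive weight. *)
Lemma conv_face s c a : {in s, forall y, dot c y <= a} ->
  conv [set` s] `&` [set y | dot c y = a] = conv [set` [seq y <- s | dot c y == a]].
Proof.
move=> sa; apply/seteqP; split; last first.
  move=> y yF; split.
    by apply: conv_mono yF => z /=; rewrite mem_filter => /andP[].
  apply: aff_dot_const (conv_sub_aff yF) => z /=.
  by rewrite mem_filter => /andP[/eqP].
move=> _ [[k [p [l [ps l0 l1 ->]]]] /= ea].
have tight i : l i != 0 -> dot c (p i) = a.
  have gap j : 0 <= l j * (a - dot c (p j)) by rewrite mulr_ge0 // subr_ge0 sa ?ps.
  have /eqP : \sum_j l j * (a - dot c (p j)) = 0.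
    under eq_bigr do rewrite mulrBr.
    rewrite sumrB -mulr_suml l1 mul1r -ea dot_sumr.
    by under eq_bigr do rewrite dotZr; rewrite subrr.
  rewrite psumr_eq0 // => /allP/(_ i (mem_index_enum i))/=.
  by rewrite mulf_eq0 => /predU1P[->|]; rewrite ?eqxx // subr_eq0 => /eqP.
have [j lj] : exists j, l j != 0.
  apply: contrapT => /forallNP lz.
  have := l1; rewrite big1 => [/esym/eqP|i _]; first by rewrite oner_eq0.
  by apply/eqP; apply: contrapT => /negP; exact: lz.
have -> : \sum_i l i *: p i = \sum_i l i *: p (if l i == 0 then j else i).
  by apply: eq_bigr => i _; case: eqP => // ->; rewrite !scale0r.
apply: conv_fin => // i /=; rewrite mem_filter; apply/andP; split; last exact: ps.
by apply/eqP; case: eqVneq => [_|li]; rewrite tight.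
Qed.

Lemma face_conv s F : face (conv [set` s]) F ->
  exists c a, {in s, forall y, dot c y <= a} /\
    F = conv [set` [seq y <- s | dot c y == a]].
Proof.
move=> [c [a [h ->]]]; exists c, a; have sa : {in s, forall y, dot c y <= a}.
  by move=> y ys; apply: h; exact: sub_conv.
by split => //; rewrite conv_face.
Qed.

Lemma conv_face_face s c a : {in s, forall y, dot c y <= a} ->
  face (conv [set` s]) (conv [set` [seq y <- s | dot c y == a]]).
Proof. by move=> sa; exists c, a; rewrite conv_face //; split=> //; exact: conv_dot_le. Qed.

Lemma face_self P : face P P.
Proof.
exists 0, 0; split=> [y _|]; first by rewrite dot0l.
by apply/seteqP; split=> [y Py|y []//]; split=> //=; rewrite dot0l.
Qed.

Lemma face_subset P F : face P F -> F `<=` P.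
Proof. by move=> [c [a [_ ->]]] y []. Qed.

Lemma face_polytope P F : polytope P -> face P F -> polytope F.
Proof. by move=> [s ->] /face_conv[c [a [_ ->]]]; eexists. Qed.

Lemma face_restrict P F G : face P F -> F `<=` G -> G `<=` P -> face G F.
Proof.
move=> [c [a [h e]]] FG GP; exists c, a; split=> [y /GP/h//|].
apply/seteqP; split=> [y Fy|y [/GP Py ya]]; last by rewrite e.
by split; [exact: FG|move: Fy; rewrite e => -[]].
Qed.

(** If c exposes F in P and e exposes G in F, then N c + e exposes G in P for
    large N: off F, the gap of c is positive on finitely many generators. *)
Lemma face_trans P F G : polytope P -> face P F -> face F G -> face P G.
Proof.
move=> [s ->] /face_conv[c [a [sa ->]]] /face_conv[e [b [fb ->]]].
pose gap y := a - dot c y.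
have [|N hN] := @dominating_scale _ [seq y <- s | dot c y != a] gap (fun y => b - dot e y).
  by move=> y; rewrite mem_filter subr_gt0 lt_neqAle => /andP[-> /sa].
have nE y : dot (N *: c + e) y = N * dot c y + dot e y by rewrite dotDl dotZl.
have lt y : y \in s -> dot c y != a -> dot (N *: c + e) y < N * a + b.
  move=> ys ca; rewrite nE; have := hN y; rewrite mem_filter ca ys => /(_ isT).
  by rewrite /gap; lra.
have eb y : y \in s -> dot c y = a -> dot e y <= b.
  by move=> ys ca; apply: fb; rewrite mem_filter ca eqxx.
have -> : [seq y <- [seq y <- s | dot c y == a] | dot e y == b] =
    [seq y <- s | dot (N *: c + e) y == N * a + b].
  rewrite -filter_predI; apply: eq_in_filter => y ys /=.
  have [ca|ca] := eqVneq (dot c y) a; last by rewrite andbF lt_eqF // lt.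
  by rewrite andbT nE ca (inj_eq (addrI _)).
apply: conv_face_face => y ys.
have [ca|ca] := eqVneq (dot c y) a; last by rewrite ltW // lt.
by rewrite nE ca lerD2l eb.
Qed.

(** A face is cut out of P by a hyperplane that contains its affine hull; if the
    two affine hulls agree, this hyperplane contains P. *)
Lemma face_dim P F k l : face P F -> has_dim P k -> has_dim F l ->
  (l <= k)%N /\ (l = k -> F = P).
Proof.
move=> fF hP hF; have FP := face_subset fF.
have [lk e] := has_dim_mono hF hP (aff_mono FP); split=> // /e eA.
move: fF => [c [a [_ eF]]]; apply/seteqP; split=> // y Py; rewrite eF; split=> //.
have : aff F y by rewrite eA; exact: sub_aff.
by move: y {Py}; apply: aff_dot_const => y; rewrite eF => -[].
Qed.

End Faces.

(** * Vertices, facets and chains of faces *)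

Section Vertices.
Local Open Scope classical_set_scope.
Local Open Scope ring_scope.
Variables (R : realType) (n : nat).
Local Notation point := 'rV[R]_n.
Implicit Types (P F G : set point) (v w x y z c e : point) (a b : R) (s : seq point).

(** Gordan's alternative, by induction on the number of points: when the
    functional c obtained for the other points is negative at v, every segment
    from v to another point meets the hyperplane of c, and the induction
    hypothesis is applied to these intersections. *)
Lemma gordan s : conv [set` s] 0 \/ exists c, {in s, forall y, 0 < dot c y}.
Proof.
elim: {s}(size s) {-2}s (leqnn (size s)) => [|m IH] [|v r] //= sm.
- by right; exists 0.
- by right; exists 0.
have rs : [set` r] `<=` [set` v :: r] by move=> y /= yr; rewrite inE yr orbT.
have vs : conv [set` v :: r] v by apply: sub_conv; rewrite /= mem_head.
have [|[c cr]] := IH r sm; first by left; exact: conv_mono rs _ _.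
have ext d : 0 < dot d v -> {in r, forall y, 0 < dot d y} ->
    exists c, {in v :: r, forall y, 0 < dot c y}.
  by move=> dv dr; exists d => y; rewrite inE => /predU1P[->|/dr].
have [cv|cv|cv] := ltgtP 0 (dot c v); first by right; exact: (ext c).
  have b0 w : w \in r -> 0 < dot c w - dot c v by move/cr; lra.
  (* cut w is the point of the segment from w to v where c vanishes *)
  pose cut w := (1 - dot c w / (dot c w - dot c v)) *: w
                + (dot c w / (dot c w - dot c v)) *: v.
  have [|c0|[d dr]] := IH (map cut r); first by rewrite size_map.
    left; apply: (@conv_sub _ _ [set` map cut r] [set` v :: r] _ _ c0).
    move=> _ /= /mapP[w wr ->]; apply: conv_convex => //.
      by apply/sub_conv/rs.
    apply/andP; split; first by apply: divr_ge0; apply: ltW; [exact: cr|exact: b0].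
    by rewrite ler_pdivrMr ?b0 // mul1r; lra.
  (* h is positive at w because d is positive at cut w, and h vanishes at v *)
  right; pose h := - dot c v *: d + dot d v *: c.
  have hv : dot h v = 0 by rewrite dotDl !dotZl; ring.
  have hr : {in r, forall w, 0 < dot h w}.
    move=> w wr; have := dr _ (map_f cut wr).
    rewrite -(pmulr_lgt0 _ (b0 w wr)) dotDr !dotZr.
    suff -> : ((1 - dot c w / (dot c w - dot c v)) * dot d w +
      dot c w / (dot c w - dot c v) * dot d v) * (dot c w - dot c v) = dot h w by [].
    by rewrite dotDl !dotZl; field; rewrite gt_eqF ?b0.
  have [N hN] := dominating_scale (fun w => - dot c w) hr.
  apply: (ext (N *: h - c)); first by rewrite dotBl dotZl hv; lra.
  by move=> w /hN; rewrite dotBl dotZl.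
have [->|v0] := eqVneq v 0; first by left; apply: sub_conv; rewrite /= mem_head.
right; have [N hN] := dominating_scale (dot v) cr.
apply: (ext (N *: c + v)); first by rewrite dotDl dotZl -cv mulr0 add0r dot_gt0.
by move=> w /hN; rewrite dotDl dotZl.
Qed.

Lemma image_seq (f : point -> point) s : f @` [set` s] = [set` map f s].
Proof.
apply/seteqP; split=> [_ [y /= ys <-]|_ /= /mapP[y ys ->]]; first exact: map_f.
by exists y.
Qed.

Lemma seq_separation s v : ~ conv [set` s] v ->
  exists c, {in s, forall y, dot c y < dot c v}.
Proof.
move=> nv; have [|[c h]] := gordan (map (fun y => v - y) s); last first.
  by exists c => y ys; have := h _ (map_f _ ys); rewrite dotBr subr_gt0.
rewrite -image_seq -image_conv => [[y ys /subr0_eq e]|k p l _ l1].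
  by case: nv; rewrite e.
under [RHS]eq_bigr do rewrite scalerBr.
by rewrite sumrB -scaler_suml l1 scale1r.
Qed.

Lemma vertex_mem s v : vertex (conv [set` s]) v -> v \in s.
Proof.
move=> /face_conv[c [a [_ e]]].
have /conv_nonempty[y /= ys] : conv [set` [seq y <- s | dot c y == a]] !=set0.
  by rewrite -e; exists v.
have /= <- : [set v] y by rewrite e; exact: sub_conv.
by move: ys; rewrite mem_filter => /andP[].
Qed.

Lemma vertex_exposed P v : vertex P v ->
  P v /\ exists c, forall y, P y -> dot c y <= dot c v /\ (dot c y = dot c v -> y = v).
Proof.
move=> [c [a [h e]]].
have [Pv va] : (P `&` [set y | dot c y = a]) v by rewrite -e.
split=> //; exists c => y Py; rewrite va; split; first exact: h.
by move=> ya; have : [set v] y by rewrite e.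
Qed.

(** In an irredundant set of generators each generator can be separated from
    the others, hence is a vertex. *)
Lemma polytope_vertices P : polytope P ->
  exists s, [/\ uniq s, P = conv [set` s] & forall v, vertex P v <-> v \in s].
Proof.
move=> [s ->]; elim: {s}(size s) {-2}s (leqnn (size s)) => [|m IH] s sm.
  exists [::]; move: sm; rewrite leqn0 => /nilP -> //; split=> // v.
  by split => // /vertex_mem.
have [[v [vs vc]]|irr] :=
    pselect (exists v, v \in s /\ conv [set` [seq y <- s | y != v]] v).
  have -> : conv [set` s] = conv [set` [seq y <- s | y != v]].
    apply/seteqP; split; last by apply: conv_mono => y /=; rewrite mem_filter => /andP[].
    apply: conv_sub => y /= ys; have [->//|yv] := eqVneq y v.
    by apply: sub_conv; rewrite /= mem_filter yv.
  apply: IH; rewrite -ltnS (leq_trans _ sm) // size_filter.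
  rewrite -(count_predC (fun y => y != v)) -[ltnLHS]addn0 ltn_add2l -has_count.
  by apply/hasP; exists v; rewrite //= eqxx.
exists (undup s); split; first exact: undup_uniq.
  by congr conv; apply/seteqP; split=> y /=; rewrite mem_undup.
move=> v; rewrite mem_undup; split; first exact: vertex_mem.
move=> vs; have [|c cs] := @seq_separation [seq y <- s | y != v] v.
  by move=> vc; apply: irr; exists v.
have sv : {in s, forall y, dot c y <= dot c v}.
  move=> y ys; have [->//|yv] := eqVneq y v.
  by apply/ltW/cs; rewrite mem_filter yv.
have := conv_face_face sv; set X := conv [set` filter _ _]; suff -> : X = [set v] by [].
rewrite /X -[RHS]conv1; congr conv; apply/seteqP; split=> [y /=|_ /= ->].
  rewrite mem_filter => /andP[/eqP e ys]; apply: contrapT => /eqP yv.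
  by have := cs y; rewrite mem_filter yv ys e ltxx => /(_ isT).
by rewrite mem_filter eqxx.
Qed.

Lemma seq_argmin (T : eqType) (r : seq T) (f : T -> R) : r != [::] ->
  exists2 x, x \in r & {in r, forall t, f x <= f t}.
Proof.
elim: r => // x r IH _; have [->|r0] := eqVneq r [::].
  by exists x; rewrite ?mem_head // => t; rewrite inE => /eqP ->.
have [y yr ym] := IH r0; have [xy|yx] := leP (f x) (f y).
  exists x; first by rewrite mem_head.
  by move=> t; rewrite inE => /predU1P[->//|/ym]; exact: le_trans.
exists y; first by rewrite inE yr orbT.
by move=> t; rewrite inE => /predU1P[->|/ym //]; exact: ltW.
Qed.

(** Turning the supporting hyperplane c = a in the direction of e until it
    meets a further generator: t is the least ratio of gaps. *)
Lemma rotate_support P c a e b : polytope P ->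
  (forall y, P y -> dot c y <= a) ->
  (forall y, P y -> dot c y = a -> dot e y <= b) ->
  (exists2 y, P y & b < dot e y) ->
  exists t, [/\ 0 < t, forall y, P y -> dot (c + t *: e) y <= a + t * b &
    exists y, [/\ P y, b < dot e y & dot (c + t *: e) y = a + t * b]].
Proof.
move=> [s ->] ca ceb [z zP zb].
pose r := [seq y <- s | b < dot e y].
have sP y : y \in s -> conv [set` s] y by exact: sub_conv.
have r0 : r != [::].
  apply/negP => /eqP r0; move: zb; apply/negP; rewrite -leNgt.
  apply: conv_dot_le zP => y /= ys; rewrite leNgt; apply/negP => yb.
  have : y \in r by rewrite mem_filter yb.
  by rewrite r0.
have [y yr ymin] := seq_argmin (fun y => (a - dot c y) / (dot e y - b)) r0.
move: yr; rewrite mem_filter => /andP[yb ys].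
pose t := (a - dot c y) / (dot e y - b).
have t0 : 0 < t.
  rewrite divr_gt0 ?subr_gt0 // lt_neqAle ca ?andbT; last exact: sP.
  by apply/eqP => /ceb; rewrite leNgt yb => /(_ (sP _ ys)).
exists t; split=> //; last first.
  by exists y; split => //; [exact: sP|rewrite dotDl dotZl /t; field; rewrite subr_eq0 gt_eqF].
apply: conv_dot_le => x /= xs; rewrite dotDl dotZl.
have cx := ca _ (sP _ xs).
have [xb|xb] := leP (dot e x) b; first by nra.
have : t <= (a - dot c x) / (dot e x - b) by apply: ymin; rewrite mem_filter xb.
by rewrite ler_pdivlMr ?subr_gt0 //; lra.
Qed.

(** If F has codimension at least 2, some functional constant on F is not
    proportional, on the directions of P, to the one defining F, and turning the
    supporting hyperplane about F yields a strictly larger proper face. *)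
Lemma facet_above P d F k : polytope P -> has_dim P d -> face P F -> has_dim F k ->
  (k < d)%N -> exists Q, [/\ face P Q, has_dim Q d.-1 & F `<=` Q].
Proof.
move=> pP dP.
elim: {k}(d.-1 - k)%N {-2}k (leqnn (d.-1 - k)) F => [|m IH] k km F fF dF kd;
  have d0 := leq_ltn_trans (leq0n k) kd.
  have ek : d.-1 = k; last by exists F; rewrite ek; split.
  by apply/eqP; rewrite eqn_leq -subn_eq0 -leqn0 km -ltnS prednK.
have [ek|nek] := eqVneq k d.-1; first by exists F; rewrite -ek; split.
have kd1 : (k.+1 < d)%N.
  by rewrite ltn_neqAle kd andbT; apply: contraNneq nek => <-.
have [v vF] := has_dim_nonempty dF.
have FP := face_subset fF; have vP := FP _ vF.
have [U dU UE] := has_dim_direction dP (sub_aff vP).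
have [V dV VE] := has_dim_direction dF (sub_aff vF).
have [c [a [ca eF]]] := fF.
have F_eq y : F y <-> P y /\ dot c y = a by rewrite eF.
have [x [xP xF]] : exists x, P x /\ ~ F x.
  apply: contrapT => /forallNP h; have : F = P.
    by apply/seteqP; split=> // y Py; apply: contrapT => Fy; apply: (h y).
  by move=> e; rewrite e in dF; rewrite (has_dim_inj dF dP) ltnn in kd.
have cx : dot c x < a.
  by rewrite lt_neqAle ca // andbT; apply/eqP => h; apply/xF/F_eq.
have /subvPn[u uU uV] : ~~ (U <= V + <[x - v]>)%VS.
  apply/negP => /dimvS; rewrite dU leqNgt => /negP; apply.
  apply: leq_ltn_trans (dimv_add_leqif _ _).1 _; rewrite dV dim_vline.
  by apply: leq_ltn_trans kd1; rewrite -[leqRHS]addn1 leq_add2l leq_b1.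
have [e0 e0V e0u] := dot_separate_vspace uV.
(* e0 is not constant on P, but may only decrease away from F *)
have [e [eV [y yP ey]]] : exists e, (forall w, w \in (V + <[x - v]>)%VS -> dot e w = 0)
    /\ exists2 y, P y & dot e v < dot e y.
  have [y [yP ye]] : exists y, P y /\ dot e0 y <> dot e0 v.
    apply: contrapT => /forallNP h; move/eqP: e0u; apply.
    have : dot e0 (v + u) = dot e0 v.
      apply: (@aff_dot_const _ _ P) => [y yP|].
        by apply: contrapT => ye; apply: (h y).
      by apply/UE; rewrite addrC addKr.
    by rewrite dotDr; lra.
  move/eqP: ye; case: ltgtP => // ye _; last by exists e0; split=> //; exists y.
  exists (- e0); split=> [w wV|]; first by rewrite dotNl e0V ?oppr0.
  by exists y => //; rewrite !dotNl ltrN2.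
have eF' w : F w -> dot e w = dot e v.
  move=> /sub_aff/VE wV; apply/eqP; rewrite -subr_eq0 -dotBr eV //.
  by apply: subvP wV; exact: addvSl.
have ex : dot e x = dot e v.
  apply/eqP; rewrite -subr_eq0 -dotBr eV //.
  by apply: (subvP (addvSr V _)); exact: memv_line.
have [||t [t0 tP [z [zP ze zt]]]] := @rotate_support P c a e (dot e v) pP ca.
  by move=> w wP wa; rewrite eF' //; apply/F_eq.
  by exists y.
pose G := P `&` [set w | dot (c + t *: e) w = a + t * dot e v].
have fG : face P G by exists (c + t *: e), (a + t * dot e v).
have GP := face_subset fG.
have FG : F `<=` G.
  by move=> w wF; have [wP wa] := (F_eq w).1 wF; split=> //=; rewrite dotDl dotZl wa eF'.
have [g dG] : exists g, has_dim G g by apply: has_dim_exists; exists v; exact: FG.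
have [kg kgE] := face_dim (face_restrict fF FG GP) dG dF.
have [gd gdE] := face_dim fG dP dG.
have {}kg : (k < g)%N.
  rewrite ltn_neqAle kg andbT; apply/eqP => /kgE e1.
  have : F z by rewrite e1; split.
  by move=> /eF' e2; rewrite e2 ltxx in ze.
have {}gd : (g < d)%N.
  rewrite ltn_neqAle gd andbT; apply/eqP => /gdE e1.
  have : G x by rewrite e1.
  by move=> -[_ /=]; rewrite dotDl dotZl ex; lra.
have [|Q [fQ dQ GQ]] := IH g _ G fG dG gd; last by exists Q; split=> // w /FG/GQ.
by rewrite -ltnS (leq_trans _ km) // ltn_sub2l // -ltnS prednK.
Qed.

(** Descending through facets that contain F leads from P to F one dimension at a
    time. The index set nat leaves the members below k arbitrary. *)
Lemma chain_above d P F k : polytope P -> has_dim P d -> face P F -> has_dim F k ->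
  exists G : nat -> set point, [/\ G k = F, G d = P,
    forall i, (k <= i <= d)%N -> face P (G i) /\ has_dim (G i) i &
    forall i j, (k <= i <= j)%N -> (j <= d)%N -> G i `<=` G j].
Proof.
elim: d P => [|d IH] P pP dP fF dF; have [kd kdE] := face_dim fF dP dF.
  move: kd dF kdE; rewrite leqn0 => /eqP -> dF FP.
  exists (fun=> P); split=> [||i|i j _ _ //]; rewrite ?FP //.
  by rewrite leqn0 => /eqP ->; split=> //; exact: face_self.
have [ek|nk] := eqVneq k d.+1.
  move: dF kdE; rewrite ek => dF FP.
  exists (fun=> P); split=> [||i|i j _ _ //]; rewrite ?FP //.
  by rewrite -eqn_leq => /eqP <-; split=> //; exact: face_self.
have {nk} {}kd : (k < d.+1)%N by rewrite ltn_neqAle nk.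
have [Q [fQ dQ FQ]] := facet_above pP dP fF dF kd.
have QP := face_subset fQ.
have [G [Gk Gd fG Gm]] := IH Q (face_polytope pP fQ) dQ (face_restrict fF FQ QP) dF.
exists (fun i => if (i <= d)%N then G i else P); split.
- by rewrite -ltnS kd.
- by rewrite ltnn.
- move=> i /andP[ki]; rewrite leq_eqVlt ltnS => /predU1P[->|id].
    by rewrite ltnn; split=> //; exact: face_self.
  rewrite id; have [|f h] := fG i; first by rewrite ki.
  by split=> //; exact: face_trans f.
- move=> i j /andP[ki ij] jd; have [jd'|jd'] := leqP j d.
    by rewrite (leq_trans ij jd'); apply: Gm; rewrite ?ki.
  case: leqP => id; last exact: subset_refl.
  have [|f _] := fG i; first by rewrite ki.
  by move=> y /(face_subset f)/QP.
Qed.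

End Vertices.

(** * Regular polytopes are uniform *)

Section Flags.
Local Open Scope classical_set_scope.
Local Open Scope ring_scope.
Variables (R : realType) (n : nat).
Local Notation point := 'rV[R]_n.
Implicit Types (P F G Q E : set point) (v w x y z c e : point) (f : point -> point).

Lemma flag_vertex d P v : polytope P -> has_dim P d -> vertex P v ->
  exists2 G : 'I_d.+1 -> set point, flag P G & G ord0 = [set v].
Proof.
move=> pP dP vP; have [G [G0 _ fG Gm]] := chain_above pP dP vP (has_dim1 v).
exists (fun i : 'I_d.+1 => G i) => //; split=> [i|i j ij].
  by apply: fG; rewrite leq0n -ltnS ltn_ord.
by apply: Gm; rewrite ?ij // -ltnS ltn_ord.
Qed.

Lemma image_set1E f v w : f @` [set v] = [set w] -> f v = w.
Proof. by move=> h; have : [set w] (f v) by rewrite -h; exists v. Qed.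

Lemma regular_vertex_transitive d P : polytope P -> has_dim P d ->
  regular_polytope d P -> vertex_transitive P.
Proof.
move=> pP dP reg v w vP wP.
have [F fF F0] := flag_vertex pP dP vP; have [G fG G0] := flag_vertex pP dP wP.
by have [f sf /(_ ord0)] := reg _ _ fF fG; rewrite F0 G0 => /image_set1E; exists f.
Qed.

Lemma symmetry_affine P f : symmetry P f -> affine_on (aff P) f.
Proof. by case=> fi _ _; exact: isometry_affine. Qed.

(** A flag of a facet extends by P itself to a flag of P, and a symmetry of P
    that matches two such extensions preserves the facet. *)
Lemma regular_facet d P F : polytope P -> has_dim P d.+1 ->
  regular_polytope d.+1 P -> face P F -> has_dim F d -> regular_polytope d F.
Proof.
move=> pP dP reg fF dF K L fK fL; have FP := face_subset fF.
(* ext K adds P on top of K; inord is only applied to indices at most d *)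
pose ext (K : 'I_d.+1 -> set point) (i : 'I_d.+2) :=
  if (i <= d)%N then K (inord i) else P.
have extE (K' : 'I_d.+1 -> set point) (i : 'I_d.+1) :
    ext K' (widen_ord (leqnSn _) i) = K' i.
  by rewrite /ext /= -ltnS ltn_ord inord_val.
have ext_flag (K' : 'I_d.+1 -> set point) : flag F K' -> flag P (ext K').
  move=> [fK' mK']; split=> [i|i j ij]; rewrite /ext.
    case: leqP => id.
      have [fi di] := fK' (inord i); split; first exact: face_trans fi.
      by rewrite inordK in di.
    split; first exact: face_self.
    by have -> : nat_of_ord i = d.+1 by apply/eqP; rewrite eqn_leq id -ltnS ltn_ord.
  case: (leqP j d) => jd.
    by rewrite (leq_trans ij jd); apply: mK'; rewrite !inordK // ltnS (leq_trans ij jd).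
  case: leqP => id; last exact: subset_refl.
  by move=> y /(face_subset (fK' (inord i)).1)/FP.
have [f sf fKL] := reg _ _ (ext_flag _ fK) (ext_flag _ fL).
have topF (K' : 'I_d.+1 -> set point) : flag F K' -> K' ord_max = F.
  by move=> [fK' _]; have [fm dm] := fK' ord_max; exact: (face_dim fm dF dm).2.
have fKL' i : f @` K i = L i by have := fKL (widen_ord (leqnSn _) i); rewrite !extE.
have fFF : f @` F = F by have := fKL' ord_max; rewrite !topF.
have FA := aff_mono FP.
exists f => //; split=> //.
  by move=> x y xF yF; case: sf => fi _ _; apply: fi; exact: FA.
rewrite image_aff ?fFF //.
apply: affine_on_sub (symmetry_affine sf).
by move=> x /FP/sub_aff.
Qed.

Lemma regular_uniform d P : polytope P -> has_dim P d.+1 ->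
  regular_polytope d.+1 P -> uniform_polytope d.+1 P.
Proof.
elim: d P => [|d IH] P pP dP reg; first by split.
case: d IH dP reg => [|d] IH dP reg; first by split.
split=> //; split; last exact: regular_vertex_transitive reg.
move=> F fF dF; apply: IH => //; first exact: face_polytope fF.
exact: regular_facet reg fF dF.
Qed.

End Flags.

(** * Improving edges *)

Section ImprovingEdge.
Local Open Scope classical_set_scope.
Local Open Scope ring_scope.
Variables (R : realType) (n : nat).
Local Notation point := 'rV[R]_n.
Implicit Types (P G Q E : set point) (v w x y z c e : point).

(** The simplex method: a vertex v that does not maximise c has an improving
    edge. Turning a hyperplane exposing v towards c until it hits a further
    generator gives a face on which c is minimal only at v, and one descends to
    it, or to a facet through v if it is everything. *)
Lemma improving_edge d P v c : polytope P -> has_dim P d -> vertex P v ->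
  (exists2 y, P y & dot c v < dot c y) ->
  exists E w, [/\ face P E /\ has_dim E 1, E v, vertex P w, E w & dot c v < dot c w].
Proof.
elim: d {-2}d (leqnn d) P => [|m IH] d dm P pP dP vP [y yP cy].
  move: dm dP; rewrite leqn0 => /eqP -> /has_dim0[u eP].
  have [] := vertex_exposed vP; move: yP; rewrite eP => /= ey ev _.
  by move: cy; rewrite ey ev ltxx.
have [vinP [e ev]] := vertex_exposed vP.
have descend Q d' : face P Q -> has_dim Q d' -> (d' < d)%N -> Q v ->
    (exists2 y, Q y & dot c v < dot c y) ->
    exists E w, [/\ face P E /\ has_dim E 1, E v, vertex P w, E w & dot c v < dot c w].
  move=> fQ dQ dd vQ yQ; have QP := face_subset fQ.
  have vQ' : vertex Q v by apply: face_restrict vP _ QP; move=> _ /= ->.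
  have [|E [w [[fE dE] vE wv wE cw]]] := IH d' _ Q (face_polytope pP fQ) dQ vQ' yQ.
    by rewrite -ltnS (leq_trans dd).
  exists E, w; split=> //; first by split=> //; exact: face_trans fE.
  exact: face_trans wv.
have [|||t [t0 tP [z [zP cz zt]]]] := @rotate_support _ _ P e (dot e v) c (dot c v) pP.
  by move=> x /ev[].
  by move=> x /ev[_ h] /h ->.
  by exists y.
pose G := P `&` [set w | dot (e + t *: c) w = dot e v + t * dot c v].
have fG : face P G by exists (e + t *: c), (dot e v + t * dot c v).
have vG : G v by split=> //=; rewrite dotDl dotZl.
have zG : G z by [].
have [g dG] : exists g, has_dim G g by apply: has_dim_exists; exists v.
have [gd gE] := face_dim fG dP dG.
have [eg|ng] := eqVneq g d; last first.
  by apply: (descend G g) => //; [rewrite ltn_neqAle ng | exists z].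
have [d1|d1] := leqP d 1.
  have {}dP : has_dim P 1.
    have [d0|d0] := posnP d; last by rewrite (_ : 1%N = d) //; apply/eqP; rewrite eqn_leq d0.
    rewrite d0 in dP; have [u eP] := has_dim0 dP.
    by move: yP vinP cy; rewrite eP => /= -> ->; rewrite ltxx.
  have [s [_ eP sv]] := polytope_vertices pP.
  have [w [ws cw]] : exists w, w \in s /\ dot c v < dot c w.
    apply: contrapT => /forallNP h; move: cy; apply/negP; rewrite -leNgt.
    rewrite eP in yP; apply: conv_dot_le yP => x /= xs; rewrite leNgt.
    by apply/negP => cx; apply: (h x).
  exists P, w; split=> //; first by split=> //; exact: face_self.
    by apply/sv.
  by rewrite eP; exact: sub_conv.
(* here G is all of P, so c exceeds its value at v everywhere else, and any facet
   through v will do *)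
have [|Q [fQ dQ vQ]] := facet_above pP dP vP (has_dim1 v); first exact: ltnW.
have QP := face_subset fQ; have {}vQ : Q v by exact: vQ.
apply: (descend Q d.-1) => //; first by rewrite prednK ?(ltnW d1).
have [x [xQ xv]] : exists x, Q x /\ x <> v.
  apply: contrapT => /forallNP h; have eQ : Q = [set v].
    apply/seteqP; split=> [x xQ /=|_ /= -> //].
    by apply: contrapT => xv; apply: (h x).
  rewrite eQ in dQ; have := has_dim_inj dQ (has_dim1 v).
  by case: d d1 {dm dP gd gE descend dQ eg} => [|[]].
exists x => //; have xP := QP _ xQ; have [ex exv] := ev _ xP.
have : G x by rewrite gE.
move=> [_ /=]; rewrite dotDl dotZl => h.
have {}ex : dot e x < dot e v by rewrite lt_neqAle ex andbT; apply/eqP => /exv.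
by rewrite -(ltr_pM2l t0); lra.
Qed.

End ImprovingEdge.

(** * Centers *)

Section Center.
Local Open Scope classical_set_scope.
Local Open Scope ring_scope.
Variables (R : realType) (n : nat).
Local Notation point := 'rV[R]_n.
Implicit Types (P F G Q E : set point) (v w x y z c e : point) (f : point -> point).

(** The image of the vertices still generates P, so it contains every vertex,
    and by counting there is nothing else in it. *)
Lemma vertices_perm P (s : seq point) f : uniq s -> P = conv [set` s] ->
  (forall v, vertex P v <-> v \in s) -> affine_on P f -> f @` P = P ->
  perm_eq s (map f s).
Proof.
move=> us eP sv fa fP.
have sP : [set` s] `<=` P by move=> y ys; rewrite eP; exact: sub_conv.
have sub : {subset s <= map f s}.
  move=> y /sv yv; apply: vertex_mem; rewrite -image_seq -image_conv -?eP ?fP //.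
  exact: affine_on_sub sP fa.
have sz : (size (map f s) <= size s)%N by rewrite size_map.
by apply: uniq_perm (leq_size_uniq us sub sz) _ => //; case: (uniq_min_size us sub sz).
Qed.

(** What the proof uses of the centroid of the vertices of P. *)
Definition is_center P (b : point) :=
  [/\ P b,
      forall c a, (forall y, P y -> dot c y <= a) -> (exists2 y, P y & dot c y < a) ->
        dot c b < a &
      forall f, affine_on P f -> f @` P = P -> f b = b].

(** With all weights of the centroid positive, a supporting hyperplane through it
    would contain every vertex. *)
Lemma center_exists P : polytope P -> P !=set0 -> exists b, is_center P b.
Proof.
move=> pP P0; have [s [us eP sv]] := polytope_vertices pP.
have s0 : (0 < size s)%N.
  move: P0; rewrite eP => /conv_nonempty[y /= ys].
  by rewrite -has_predT; apply/hasP; exists y.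
pose l (i : 'I_(size s)) : R := (size s)%:R^-1; pose p (i : 'I_(size s)) := s`_i.
have N0 : (size s)%:R != 0 :> R by rewrite pnatr_eq0 -lt0n.
have l0 i : 0 < l i by rewrite invr_gt0 ltr0n.
have l1 : \sum_i l i = 1.
  by rewrite sumr_const card_ord -[LHS]mulr_natr mulVf.
have ps i : p i \in s by exact: mem_nth.
have pP' i : P (p i) by rewrite eP; exact: sub_conv (ps i).
pose b := \sum_i l i *: p i; exists b; split.
- by rewrite eP; apply: conv_fin => // i; exact: ltW.
- move=> c a ca [y yP ya].
  have gap i : 0 <= l i * (a - dot c (p i)).
    by rewrite mulr_ge0 ?subr_ge0 ?ca //; exact: ltW.
  have eb : a - dot c b = \sum_i l i * (a - dot c (p i)).
    under eq_bigr do rewrite mulrBr.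
    rewrite sumrB -mulr_suml l1 mul1r dot_sumr.
    by congr (_ - _); apply: eq_bigr => i _; rewrite dotZr.
  rewrite -subr_gt0 eb lt0r sumr_ge0 // andbT psumr_eq0 //.
  apply/negP => /allP h; move: ya; apply/negP; rewrite -leNgt.
  suff -> : dot c y = a by [].
  rewrite eP in yP; apply: (@aff_dot_const _ _ [set` s]); last exact: conv_sub_aff.
  move=> x /= xs; have xi : (index x s < size s)%N by rewrite index_mem.
  have := h (Ordinal xi) (mem_index_enum _).
  by rewrite /= mulf_eq0 gt_eqF //= /p /= nth_index // subr_eq0 => /eqP.
- move=> f fa fP.
  have sP : [set` s] `<=` P by move=> y ys; rewrite eP; exact: sub_conv.
  have pe := vertices_perm us eP sv fa fP.
  have bE : b = (size s)%:R^-1 *: \sum_(y <- s) y.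
    by rewrite (big_nth 0) big_mkord scaler_sumr.
  rewrite fa // -scaler_sumr bE; congr (_ *: _).
  by rewrite [RHS](perm_big _ pe) big_map (big_nth 0) big_mkord.
Qed.

(** A choice that depends on the set P alone, so that the centers of the members
    of a flag do not refer to lists of generators. *)
Definition center P : point := xget 0 (is_center P).

Lemma centerP P : polytope P -> P !=set0 -> is_center P (center P).
Proof. by move=> pP P0; exact: (xgetPex 0 (center_exists pP P0)). Qed.

End Center.

(** * Reflections *)

Section Reflections.
Local Open Scope classical_set_scope.
Local Open Scope ring_scope.
Variables (R : realType) (n : nat).
Local Notation point := 'rV[R]_n.
Implicit Types (P F G Q E : set point) (v w x y z c e a t : point) (f : point -> point).

Lemma mul_reflection a x : x *m reflection_mx a = x - (2 * dot x a / dot a a) *: a.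
Proof.
rewrite mulmxBr mulmx1 -scalemxAr mulmxA; congr (_ - _).
rewrite [x *m a^T]mx11_scalar mul_scalar_mx scalerA /dot; congr (_ *: _).
by rewrite mulrAC.
Qed.

Lemma reflection_orthogonal a : a != 0 -> orthogonal_group (reflection_mx a).
Proof.
move=> a0; have aa := dot_gt0 a0; rewrite /orthogonal_group /=.
have -> : (reflection_mx a)^T = reflection_mx a.
  by rewrite /reflection_mx linearB /= linearZ /= trmx_mul trmxK trmx1.
apply/row_matrixP => i; rewrite !rowE mulmxA !mul_reflection mulmx1.
set x := delta_mx _ _; rewrite dotBl dotZl.
rewrite -addrA -opprD -scalerDl.
suff -> : 2 * dot x a / dot a a +
  2 * (dot x a - 2 * dot x a / dot a a * dot a a) / dot a a = 0.
  by rewrite scale0r subr0.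
by field; rewrite gt_eqF.
Qed.

(** By dimension U and a span the space, and the difference of z and its
    projection to a is orthogonal to both. *)
Lemma orthogonal_line (U : {vspace point}) a z : (\dim U).+1 = n -> a != 0 ->
  {in U, forall u, dot a u = 0} -> {in U, forall u, dot z u = 0} ->
  exists k, z = k *: a.
Proof.
move=> dU a0 aU zU; have aa := dot_gt0 a0.
have naU : a \notin U by apply/negP => /aU e; rewrite e ltxx in aa.
have full : (U + <[a]>)%VS = fullv.
  by apply/eqP; rewrite eqEdim subvf /= dim_point dimv_add_line // dU.
exists (dot z a / dot a a); apply/eqP; rewrite -subr_eq0; apply/eqP/dot_eq0.
set z' := z - _; have : z' \in (U + <[a]>)%VS by rewrite full memvf.
move=> /memv_addP[u uU [_ /vlineP[k ->] {2}->]].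
rewrite dotDr dotZr /z' !dotBl !dotZl (zU u uU) (aU u uU).
by field; rewrite gt_eqF.
Qed.

(** Both y and f y are at the same distance from p, and from q; subtracting the
    two equations leaves a linear one. *)
Lemma isometry_fix_orthogonal f p q y :
  (forall x y, dist (f x) (f y) = dist x y) -> f p = p -> f q = q ->
  dot (f y - y) (p - q) = 0.
Proof.
move=> fi fp fq; have := dist_eq (fi y p); have := dist_eq (fi y q).
rewrite fp fq !dot_linear (dotC p (f y)) (dotC q (f y)) (dotC p y) (dotC q y).
by lra.
Qed.

(** If y is displaced by k (w - v), its unchanged distances to t and from v to w
    give two quadratic equations for k, whose difference is linear; together with
    dist v t = dist w t it yields the coefficient of the reflection. *)
Lemma isometry_reflection f t v w :
  (forall x y, dist (f x) (f y) = dist x y) -> f t = t -> f v = w -> v != w ->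
  (forall y, exists k, f y - y = k *: (w - v)) ->
  forall y, f y = t + (y - t) *m reflection_mx (w - v).
Proof.
move=> fi ft fv vw fk y; have [k ek] := fk y.
have aa : 0 < dot (w - v) (w - v) by rewrite dot_gt0 // subr_eq0 eq_sym.
have h1 := dist_eq (fi y v); have h2 := dist_eq (fi y t); have h3 := dist_eq (fi v t).
have fy : f y = y + k *: (w - v) by rewrite -ek addrC subrK.
rewrite fv ft in h1 h2 h3.
pose a := w - v; have ew : w = v + a by rewrite /a addrC subrK.
rewrite mul_reflection addrA addrCA subrr addr0 fy; congr (_ + _).
rewrite -scaleNr; congr (_ *: _).
rewrite fy in h1 h2; rewrite -/a in h1 h2 aa *; rewrite ew in h1 h3.
clearbody a.
have e1 : y + k *: a - (v + a) = (y - v) + (k - 1) *: a.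
  by rewrite scalerBl scale1r opprD !addrA; congr (_ - _); rewrite addrAC.
have e2 : y + k *: a - t = (y - t) + k *: a by rewrite addrAC.
have e3 : v + a - t = (v - t) + a by rewrite addrAC.
have e4 : y - v = (y - t) - (v - t) by rewrite opprB addrA subrK.
rewrite e1 e4 in h1; rewrite e2 in h2; rewrite e3 in h3.
move: (y - t) (v - t) h1 h2 h3 => p q.
rewrite !dot_linear !(dotC a) (dotC q p) => h1 h2 h3.
apply: (mulIf (lt0r_neq0 aa)); rewrite mulNr divfK ?gt_eqF //.
have : k * dot a a + 2 * dot p a = 0 by nra.
lra.
Qed.

End Reflections.

(** * Reflections along the edges of a regular polytope *)

Section EdgeReflections.
Local Open Scope classical_set_scope.
Local Open Scope ring_scope.
Variables (R : realType) (n : nat).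
Local Notation point := 'rV[R]_n.
Implicit Types (P E : set point) (v w x y z c a : point) (f : point -> point).

(** A subspace of too small a dimension extends to one of dimension n - 1, and a
    translate of the latter would contain P. *)
Lemma non_degenerate_full P : (0 < n)%N -> non_degenerate P ->
  has_dim P n /\ aff P = setT.
Proof.
move=> n0 nd.
have ext m (U : {vspace point}) : (\dim U <= m <= n)%N ->
    exists2 V : {vspace point}, (U <= V)%VS & \dim V = m.
  elim: m => [|m IH] /andP[Um mn].
    by exists U => //; apply/eqP; rewrite -leqn0.
  move: Um; rewrite leq_eqVlt => /predU1P[e|Um]; first by exists U.
  have [|V UV dV] := IH; first by rewrite -ltnS Um ltnW.
  have /subvPn[u _ uV] : ~~ (fullv <= V)%VS.
    by apply/negP => /dimvS; rewrite dim_point dV leqNgt mn.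
  exists (V + <[u]>)%VS; last by rewrite dimv_add_line // dV.
  exact: subv_trans UV (addvSl _ _).
have P0 : P !=set0.
  apply: contrapT => /nonemptyPn P0.
  have [|V _ dV] := ext n.-1 0%VS; first by rewrite dimv0 leq_pred.
  apply: (nd [set 0 + u | u in [set` V]]); first by exists 0, V.
  by rewrite P0.
have [k dP] := has_dim_exists P0.
have [v vP] := P0; have [U dU UE] := has_dim_direction dP (sub_aff vP).
have kn : k = n.
  have kn : (k <= n)%N by rewrite -dU -[leqRHS](dim_point R n) dimvS ?subvf.
  apply/eqP; rewrite eqn_leq kn /= leqNgt {kn}.
  apply/negP => kn.
  have [|V UV dV] := ext n.-1 U; first by rewrite dU -ltnS prednK // kn leq_pred.
  apply: (nd [set v + u | u in [set` V]]); first by exists v, V.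
  move=> y /sub_aff/UE yU; exists (y - v); last by rewrite addrC subrK.
  exact: subvP UV _ yU.
split; first by move: dP; rewrite kn.
apply/seteqP; split=> // y _; apply/UE.
have -> : U = fullv by apply/eqP; rewrite eqEdim subvf dim_point dU kn /=.
exact: memvf.
Qed.

Lemma symmetry_isometry P f : aff P = setT -> symmetry P f ->
  forall x y, dist (f x) (f y) = dist x y.
Proof. by move=> PT [fi _ _] x y; apply: fi; rewrite PT. Qed.

(** The centers of the members of a flag are affinely independent, because each
    of them lies outside the affine hull of the preceding member. *)
Lemma centers_span P (G : nat -> set point) d : polytope P ->
  (forall i, (1 <= i <= d)%N -> face P (G i) /\ has_dim (G i) i) ->
  (forall i j, (1 <= i <= j)%N -> (j <= d)%N -> G i `<=` G j) ->
  forall k, (k < d)%N -> exists U : {vspace point}, [/\ \dim U = k,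
    {in U, forall u, aff (G k.+1) (center (G 1%N) + u)} &
    forall z, (forall i, (1 <= i <= d)%N -> dot z (center (G i) - center (G 1%N)) = 0) ->
      {in U, forall u, dot z u = 0}].
Proof.
move=> pP fG Gm.
have cG i : (1 <= i <= d)%N -> is_center (G i) (center (G i)).
  by move=> /fG[fi di]; apply: centerP (face_polytope pP fi) (has_dim_nonempty di).
elim=> [|k IH] kd.
  exists 0%VS; split=> [|u|z _ u]; rewrite ?dimv0 // memv0 => /eqP ->.
    by rewrite addr0; apply: sub_aff; have [] := cG 1%N kd.
  by rewrite dot0r.
have [U [dU UG Uz]] := IH (ltnW kd).
have [fk dk] := fG k.+1 (ltnW kd); have [fk' dk'] := fG k.+2 kd.
have Gk : G k.+1 `<=` G k.+2 by apply: Gm => //=.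
pose b := center (G k.+2); pose b1 := center (G 1%N).
have [bG bin _] := cG k.+2 kd.
have nb : ~ aff (G k.+1) b.
  have [c [a [ca eG]]] := face_restrict fk Gk (face_subset fk').
  have lt : exists2 y, G k.+2 y & dot c y < a.
    apply: contrapT => h.
    have e : G k.+1 = G k.+2.
      rewrite eG; apply/seteqP; split=> [y []//|y yG]; split=> //=.
      apply/eqP; rewrite eq_le ca //= leNgt; apply/negP => ya.
      by apply: h; exists y.
    rewrite e in dk; have /eqP := has_dim_inj dk dk'.
    by rewrite eqn_leq ltnn andbF.
  move=> h; have : dot c b = a.
    by apply: aff_dot_const h => y; rewrite eG => -[].
  by have := bin c a ca lt; rewrite -/b => /[swap] ->; rewrite ltxx.
have nbU : b - b1 \notin U.
  by apply/negP => /UG; rewrite addrC subrK.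
exists (U + <[b - b1]>)%VS; split; first by rewrite dimv_add_line // dU.
  move=> w /memv_addP[u /UG uG [_ /vlineP[l ->] ->]]; rewrite addrA.
  have GA := aff_mono Gk; apply: aff_line; first exact: GA.
    exact: sub_aff.
  by apply: GA; have := UG 0 (mem0v U); rewrite addr0.
move=> z zb w /memv_addP[u uU [_ /vlineP[l ->] ->]].
by rewrite dotDr dotZr (Uz z zb) // zb // mulr0 addr0.
Qed.

(** The symmetry matching the two flags that differ only in the endpoint of the
    edge vw fixes the centers of all other members, hence a hyperplane. *)
Lemma edge_reflection P E v w : polytope P -> has_dim P n -> aff P = setT ->
  regular_polytope n P -> face P E -> has_dim E 1 ->
  vertex P v -> vertex P w -> E v -> E w -> v != w -> (0 < n)%N ->
  symmetry P (fun y => center P + (y - center P) *m reflection_mx (w - v)) /\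
  center P + (v - center P) *m reflection_mx (w - v) = w.
Proof.
move=> pP dP PT reg fE dE vP wP vE wE vw n0.
have [G [G1 Gn fG Gm]] := chain_above pP dP fE dE.
(* the flags K v and K w differ only in their vertex *)
pose K u (i : 'I_n.+1) := if i == ord0 then [set u] else G i.
have i0 (i : 'I_n.+1) : i != ord0 -> (1 <= i <= n)%N.
  by move=> h; rewrite lt0n h -ltnS ltn_ord.
have K_flag u : vertex P u -> E u -> flag P (K u).
  move=> uP uE; split=> [i|i j ij]; rewrite /K.
    case: eqVneq => [->|/i0/fG//]; split=> //; exact: has_dim1.
  have [_|ni] := eqVneq i ord0.
    case: eqVneq => [_|/i0/andP[j1 jn]]; first exact: subset_refl.
    by move=> _ /= ->; apply: (Gm 1%N j); rewrite ?G1 ?j1.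
  have ij' : (1 <= i <= j)%N by rewrite ij andbT; case/andP: (i0 i ni).
  case: eqVneq ij' => [->|nj] ij'.
    by move: ij'; rewrite /= leqn0 => /andP[/[swap] /eqP ->].
  by apply: Gm => //; case/andP: (i0 j nj).
have [f sf fK] := reg _ _ (K_flag v vP vE) (K_flag w wP wE).
have fi := symmetry_isometry PT sf.
have fv : f v = w by have := fK ord0; rewrite /K eqxx; exact: image_set1E.
have faff : affine_on setT f by rewrite -PT; exact: symmetry_affine.
have fc i : (1 <= i <= n)%N -> f (center (G i)) = center (G i).
  move=> hi; have [fGi dGi] := fG i hi; have /andP[i1 iN] := hi.
  have [_ _ h] := centerP (face_polytope pP fGi) (has_dim_nonempty dGi).
  apply: h; first exact: affine_on_sub faff.
  have lt : (i < n.+1)%N by [].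
  have ni : Ordinal lt != ord0 by rewrite -val_eqE /= -lt0n.
  by have := fK (Ordinal lt); rewrite /K (negbTE ni).
have ft : f (center P) = center P by rewrite -Gn fc // n0 leqnn.
have orth y i : (1 <= i <= n)%N -> dot (f y - y) (center (G i) - center (G 1%N)) = 0.
  by move=> hi; apply: isometry_fix_orthogonal; rewrite ?fc.
have [|U [dU _ Uz]] := centers_span pP fG Gm (k := n.-1); first by rewrite prednK.
have wv0 : w - v != 0 by rewrite subr_eq0 eq_sym.
have fE' := isometry_reflection fi ft fv vw _.
have fR : f = fun y => center P + (y - center P) *m reflection_mx (w - v).
  apply/funext => y; apply: fE' => x.
  apply: (@orthogonal_line _ _ U) => //; first by rewrite dU prednK.
    by rewrite -fv; apply: Uz => i; exact: orth.
  by apply: Uz => i; exact: orth.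
by rewrite -fR; split=> //; rewrite -fv [in RHS]fR fv.
Qed.

End EdgeReflections.

(** * The reflection group *)

Section ReflectionGroup.
Local Open Scope classical_set_scope.
Local Open Scope ring_scope.
Variables (R : realType) (n : nat).
Local Notation point := 'rV[R]_n.
Implicit Types (P F G Q E : set point) (v w x y z c e a t : point) (f : point -> point).
Implicit Types (M N : 'M[R]_n) (S W : set 'M[R]_n).

(** The linear symmetries of the translate P - t. *)
Definition symmetry_group P t : set 'M[R]_n :=
  [set M | orthogonal_group M /\ forall y, P (t + y) <-> P (t + y *m M)].

Lemma orthogonal_trK M y : orthogonal_group M -> y *m M *m M^T = y.
Proof. by move=> oM; rewrite -mulmxA oM mulmx1. Qed.

Lemma orthogonal_trKV M y : orthogonal_group M -> y *m M^T *m M = y.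
Proof. by move=> /mulmx1C oM; rewrite -mulmxA oM mulmx1. Qed.

Lemma orthogonal_inv M : orthogonal_group M -> invmx M = M^T.
Proof.
move=> oM; have [uM _] := mulmx1_unit oM.
by rewrite -[RHS](mulKmx uM) oM mulmx1.
Qed.

Lemma symmetry_group_subgroup P t : orthogonal_subgroup (symmetry_group P t).
Proof.
split=> [M []//||M N [oM MP] [oN NP]|M [oM MP]].
- by split=> [|y]; rewrite /orthogonal_group /= ?trmx1 mulmx1.
- split=> [|y]; last by rewrite mulmxA -NP -MP.
  by rewrite /orthogonal_group /= trmx_mul mulmxA -(mulmxA M) oN mulmx1 oM.
- rewrite orthogonal_inv //; split=> [|y].
    by rewrite /orthogonal_group /= trmxK; apply: mulmx1C.
  by rewrite (MP (y *m M^T)) orthogonal_trKV.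
Qed.

(** A linear symmetry permutes the finitely many vertices and is determined by
    this permutation, the vertices spanning the space affinely. *)
Lemma symmetry_group_finite P t : polytope P -> aff P = setT ->
  finite_set (symmetry_group P t).
Proof.
move=> pP PT; have [s [us eP sv]] := polytope_vertices pP.
pose m := size s.
(* coded h: the linear symmetries that induce the permutation h of the vertices *)
pose coded (h : {ffun 'I_m -> 'I_m}) : set 'M[R]_n :=
  [set M | symmetry_group P t M /\ forall i : 'I_m, t + (s`_i - t) *m M = s`_(h i)].
have coded_inj h M N : coded h M -> coded h N -> M = N.
  move=> [_ hM] [_ hN].
  have agree y : (y - t) *m M = (y - t) *m N.
    have : aff [set` s] y by rewrite -aff_conv -eP PT.
    move: y; apply: aff_least => [x y z b hx hy hz /=|y /= ys].
      have yz : y - z = (y - t) - (z - t) by rewrite opprB addrA subrK.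
      have -> : x + b *: (y - z) - t = (x - t) + b *: ((y - t) - (z - t)).
        by rewrite addrAC yz.
      by rewrite !(mulmxDl (x - t)) -!scalemxAl !(mulmxBl (y - t)) hx hy hz.
    have yi : (index y s < m)%N by rewrite index_mem.
    have /= := hM (Ordinal yi); rewrite -(hN (Ordinal yi)) /= nth_index //.
    by move=> /addrI.
  apply/row_matrixP => i; rewrite !rowE.
  by have := agree (delta_mx 0 i + t); rewrite addrK.
apply: (@sub_finite_set _ _ ((fun h => xget 0 (coded h)) @` setT)); last first.
  exact/finite_image/finite_finset.
move=> M SM; have [oM MP] := SM.
pose f y := t + (y - t) *m M.
have fa : affine_on P f.
  move=> k p l _ l1; rewrite /f; under [RHS]eq_bigr do rewrite scalerDr.
  rewrite big_split /= -scaler_suml l1 scale1r; congr (_ + _).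
  under [RHS]eq_bigr do rewrite scalemxAl scalerBr.
  by rewrite -mulmx_suml sumrB -scaler_suml l1 scale1r.
have fP : f @` P = P.
  apply/seteqP; split=> [_ [y yP <-]|y yP].
    by apply: (MP _).1; rewrite addrC subrK.
  exists (t + (y - t) *m M^T).
    by apply: (MP _).2; rewrite orthogonal_trKV // addrC subrK.
  by rewrite /f addrAC subrr add0r orthogonal_trKV // addrC subrK.
have pe := vertices_perm us eP sv fa fP.
have fs (i : 'I_m) : (index (f (nth 0%R s i)) s < m)%N.
  by rewrite index_mem (perm_mem pe) map_f // mem_nth.
pose h := [ffun i : 'I_m => Ordinal (fs i)].
have cM : coded h M.
  by split=> // i; rewrite ffunE /= nth_index // -index_mem.
exists h => //; apply: (coded_inj h) => //.
by apply: (xgetPex 0); exists M.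
Qed.

Lemma symmetry_group_reflection P t a : a != 0 ->
  symmetry P (fun y => t + (y - t) *m reflection_mx a) ->
  symmetry_group P t (reflection_mx a).
Proof.
move=> a0 [_ _ sP]; have oM := reflection_orthogonal a0; split=> // y; split=> yP.
  by rewrite -sP; exists (t + y) => //; rewrite addrAC subrr add0r.
move: yP; rewrite -{1}sP => -[x xP /addrI /(congr1 (mulmxr (reflection_mx a)^T))/=].
by rewrite !orthogonal_trK // => <-; rewrite addrC subrK.
Qed.

Definition reflection_group P t : set 'M[R]_n :=
  smallest (@orthogonal_subgroup R n)
    [set M | [set reflection_mx a | a in [set~ 0]] M /\ symmetry_group P t M].

Lemma reflection_group_sub P t : reflection_group P t `<=` symmetry_group P t.
Proof. by apply: smallest_sub; [exact: symmetry_group_subgroup | move=> M []]. Qed.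

(** If an orbit of vertices did not contain the vertex p, exposed by c, a member
    of the orbit maximising c would have an improving edge, and the reflection
    of that edge would lead to a better member of the orbit. *)
Lemma reflection_group_transitive P v p : (0 < n)%N -> polytope P ->
  has_dim P n -> aff P = setT -> regular_polytope n P -> vertex P v -> vertex P p ->
  exists2 M, reflection_group P (center P) M & p = center P + (v - center P) *m M.
Proof.
move=> n0 pP dP PT reg vP pvP; set t := center P.
have [s [us eP sv]] := polytope_vertices pP.
pose inO u := `[<exists2 M, reflection_group P t M & u = t + (v - t) *m M>].
have vO : v \in [seq u <- s | inO u].
  rewrite mem_filter; apply/andP; split; last exact/sv.
  apply/asboolP; exists 1%:M; first by move=> H [[]].
  by rewrite mulmx1 addrC subrK.
have [pP' [c cp]] := vertex_exposed pvP.
have [|u uO umax] := seq_argmin (fun u => - dot c u) (r := [seq u <- s | inO u]).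
  by apply/eqP => e; rewrite e in vO.
move: uO; rewrite mem_filter => /andP[/asboolP[M WM eu] /sv us'].
have [uinP _] := vertex_exposed us'.
suff up : u = p by exists M => //; rewrite -up.
have [cu ->//] := cp u uinP.
apply/eqP; rewrite eq_le cu /= leNgt; apply/negP => lt.
have [|E [w [[fE dE] uE wP wE cw]]] := improving_edge pP dP us' (c := c).
  by exists p.
have uw : u != w by apply: contraTneq cw => ->; rewrite ltxx.
have [sR eR] := edge_reflection pP dP PT reg fE dE us' wP uE wE uw n0.
have wu0 : w - u != 0 by rewrite subr_eq0 eq_sym.
have RM := symmetry_group_reflection wu0 sR.
have wO : w \in [seq u <- s | inO u].
  rewrite mem_filter; apply/andP; split; last exact/sv.
  apply/asboolP; exists (M *m reflection_mx (w - u)).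
    move=> H [HH SH]; have [_ _ HM _] := HH; apply: HM; first exact: WM.
    by apply: SH; split=> //; exists (w - u) => //; apply/eqP.
  by rewrite mulmxA -[LHS]eR -/t {1}eu addrAC subrr add0r.
by have := umax _ wO; rewrite lerN2 leNgt cw.
Qed.

(** P is the hull of its vertices, which form a single orbit, and conversely the
    group preserves P. *)
Lemma reflection_orbit_hull P v (t := center P) : (0 < n)%N -> polytope P ->
  has_dim P n -> aff P = setT -> regular_polytope n P -> vertex P v ->
  P = [set t + y | y in conv [set (v - t) *m M | M in reflection_group P t]].
Proof.
move=> n0 pP dP PT reg vP; have [s [us eP sv]] := polytope_vertices pP.
apply/seteqP; split=> [y yP|_ [y yW <-]].
  exists (y - t); last by rewrite addrC subrK.
  rewrite eP in yP; move: y yP.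
  apply: conv_least => [x y a hx hy ha /=|y /= /sv yP].
    have -> : (1 - a) *: x + a *: y - t = (1 - a) *: (x - t) + a *: (y - t).
      by rewrite !scalerBr addrACA -opprD -scalerDl subrK scale1r.
    exact: conv_convex.
  have [M WM ->] := reflection_group_transitive n0 pP dP PT reg vP yP.
  by apply: sub_conv; exists M => //; rewrite addrAC subrr add0r.
have : conv P (t + y); last by rewrite {1}eP => h; rewrite eP; apply: conv_sub h.
move: y yW; apply: conv_least => [x y a hx hy ha|_ [M /reflection_group_sub[_ MP] <-]] /=.
  have -> : t + ((1 - a) *: x + a *: y) = (1 - a) *: (t + x) + a *: (t + y).
    by rewrite !scalerDr addrACA -scalerDl subrK scale1r.
  exact: conv_convex.
apply: sub_conv; apply: (MP _).1.
by rewrite addrC subrK; have [] := vertex_exposed vP.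
Qed.

End ReflectionGroup.

Theorem theorem3 (R : realType) (n : nat) (hn : (0 < n)%N)
    (P : set 'rV[R]_n) (hP : polytope P) (hnd : non_degenerate P)
    (hreg : regular_polytope n P) :
  wythoffian P.
Proof.
have [dP PT] := non_degenerate_full hn hnd.
split; first by exists n.-1.+1; apply: regular_uniform; rewrite ?prednK.
have [s [us eP sv]] := polytope_vertices hP.
have [v vs] : exists v, v \in s.
  by have := has_dim_nonempty dP; rewrite eP => /conv_nonempty[v vs]; exists v.
pose t := center P; exists (reflection_group P t), (v - t)%R, t; split; last first.
  by apply: reflection_orbit_hull => //; apply/sv.
split; last by eexists; last reflexivity; move=> M [].
exact: sub_finite_set (@reflection_group_sub _ _ P t) (symmetry_group_finite t hP PT).
Qed.
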